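(* Let $T_1,\dots,T_n$ be functions on $[a,b]$, let $u$ be a weight function on $[a,b]$ (not required to be positive), and let $\mu$ be a function on $[a,b]$. Let $A$ and $B$ be the $n\times n$ matrices with entries $$B_{ij}=\int_a^b u(x)T_i(x)\overline{T_j(x)}\,dx,\qquad A_{ij}=\int_a^b u(x)\mu(x)T_i(x)\overline{T_j(x)}\,dx,$$ and assume that $B$ is invertible. If there is an $n$-term quadrature $\{x_j,w_j\}$ that integrates $A$ and $B$, then $$\lambda_j(AB^{-1})=\mu(x_j),\qquad v_j(AB^{-1})=T(n,x_j),\qquad j=1,\dots,n,$$ that is, the eigenvalues of $AB^{-1}$ are $\mu(x_1),\dots,\mu(x_n)$ with corresponding eigenvectors $T(n,x_1),\dots,T(n,x_n)$.
   Context: The functions $T_i\in L^2[a,b]$ and $\mu$ may be complex-valued and have well-defined point values, and the integrals defining $A,B$ are assumed to exist. For $c\in[a,b]$, $T(n,c)=(T_1(c),\dots,T_n(c))^{\mathsf T}\in\mathbb{C}^n$. An $n$-term quadrature $\{x_j,w_j\}$ has distinct nodes $x_j\in[a,b]$ and nonzero weights $w_j$, $j=1,\dots,n$. It integrates $B$ and $A$ if, for all $1\le i,k\le n$, $B_{ik}=\sum_{j=1}^n w_jT_i(x_j)\overline{T_k(x_j)}$ and $A_{ik}=\sum_{j=1}^n w_j\mu(x_j)T_i(x_j)\overline{T_k(x_j)}$. $\lambda_j(M)$ and $v_j(M)$ denote the $j$-th eigenvalue and corresponding eigenvector (defined up to scaling) of a matrix $M$. *)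

(* Defs.v *)
From HB Require Import structures.
From mathcomp Require Import all_boot all_order all_algebra.
From mathcomp Require Import all_classical all_reals all_analysis.
From mathcomp Require Import complex.

Set Implicit Arguments.
Unset Strict Implicit.
Unset Printing Implicit Defensive.

Import Order.TTheory GRing.Theory Num.Theory.
Import numFieldNormedType.Exports.

Local Open Scope classical_set_scope.
Local Open Scope ring_scope.
Local Open Scope complex_scope.

(* Functions on [a, b] are total functions on R of which only the values on
   `[a, b] matter.  They have actual point values (they are not a.e. classes).
   Complex integrals are Lebesgue integrals of the real and imaginary parts,
   with respect to the completed measure: MathComp-Analysis's lebesgue_measure
   lives on the Borel sets only and would restrict to Borel functions. *)

(* The line with the sigma-algebra of all Lebesgue measurable sets. *)
Notation lebesgue_type R :=
  (caratheodory_type (lebesgue_stieltjes_measure.wlength (@idfun R))^*%mu).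

Definition cintegrable (R : realType) (a b : R) (f : R -> R[i]) : Prop :=
  (@completed_lebesgue_measure R).-integrable `[a, b] (fun x => (complex.Re (f x))%:E) /\
  (@completed_lebesgue_measure R).-integrable `[a, b] (fun x => (complex.Im (f x))%:E).

Definition cintegral (R : realType) (a b : R) (f : R -> R[i]) : R[i] :=
  Rintegral (@completed_lebesgue_measure R) `[a, b] (fun x => complex.Re (f x)) +i*
  Rintegral (@completed_lebesgue_measure R) `[a, b] (fun x => complex.Im (f x)).

Definition square_integrable (R : realType) (a b : R) (f : R -> R[i]) : Prop :=
  [/\ measurable_fun (T := lebesgue_type R) (U := measurableTypeR R)
        `[a, b] (fun x => complex.Re (f x)),
      measurable_fun (T := lebesgue_type R) (U := measurableTypeR R)
        `[a, b] (fun x => complex.Im (f x)) &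
      (@completed_lebesgue_measure R).-integrable `[a, b]
        (fun x => (complex.Re (f x) ^+ 2 + complex.Im (f x) ^+ 2)%:E)].

(* The integrand g T_i conj(T_k); g = u gives B, and g = u mu gives A. *)
Definition gram_integrand (R : realType) (n : nat) (g : R -> R[i])
    (T : 'I_n -> R -> R[i]) (i k : 'I_n) (x : R) : R[i] :=
  g x * T i x * (T k x)^*.

Definition gram_mx (R : realType) (a b : R) (n : nat) (g : R -> R[i])
    (T : 'I_n -> R -> R[i]) : 'M[R[i]]_n :=
  \matrix_(i < n, k < n) cintegral a b (gram_integrand g T i k).

Definition gram_exists (R : realType) (a b : R) (n : nat) (g : R -> R[i])
    (T : 'I_n -> R -> R[i]) : Prop :=
  forall i k : 'I_n, cintegrable a b (gram_integrand g T i k).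

Definition is_quadrature (R : realType) (a b : R) (n : nat)
    (x : 'I_n -> R) (w : 'I_n -> R[i]) : Prop :=
  [/\ injective x,
      forall j, a <= x j <= b &
      forall j, w j != 0].

Definition integratesB (R : realType) (n : nat) (T : 'I_n -> R -> R[i])
    (x : 'I_n -> R) (w : 'I_n -> R[i]) (B : 'M[R[i]]_n) : Prop :=
  forall i k : 'I_n,
    B i k = \sum_(j < n) w j * T i (x j) * (T k (x j))^*.

Definition integratesA (R : realType) (n : nat) (mu : R -> R[i])
    (T : 'I_n -> R -> R[i]) (x : 'I_n -> R) (w : 'I_n -> R[i])
    (A : 'M[R[i]]_n) : Prop :=
  forall i k : 'I_n,
    A i k = \sum_(j < n) w j * mu (x j) * T i (x j) * (T k (x j))^*.

Definition Tvec (R : realType) (n : nat) (T : 'I_n -> R -> R[i]) (c : R) :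
    'cV[R[i]]_n :=
  \col_(i < n) T i c.

(* lam lists all eigenvalues of M, with algebraic multiplicity, and v lists
   corresponding (right, column) eigenvectors.  The eigenvectors are required
   to be linearly independent: otherwise, for a repeated eigenvalue, one and
   the same eigenvector could be listed several times.  MathComp's eigenvalue
   and eigenspace are about row vectors, hence are not used here. *)
Definition eigensystem (K : fieldType) (n : nat) (M : 'M[K]_n)
    (lam : 'I_n -> K) (v : 'I_n -> 'cV[K]_n) : Prop :=
  [/\ char_poly M = \prod_(j < n) ('X - (lam j)%:P),
      forall j, v j != 0 /\ M *m v j = lam j *: v j &
      (\matrix_(i < n, j < n) v j i ord0) \in unitmx].

(* Main.v *)
Require Import Defs.
From HB Require Import structures.
From mathcomp Require Import all_boot all_order all_algebra.
From mathcomp Require Import all_classical all_reals all_analysis.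
From mathcomp Require Import complex.

Set Implicit Arguments.
Unset Strict Implicit.
Unset Printing Implicit Defensive.

Import Order.TTheory GRing.Theory Num.Theory.
Import numFieldNormedType.Exports.

Local Open Scope classical_set_scope.
Local Open Scope ring_scope.
Local Open Scope complex_scope.

(** Evaluating the quadrature turns the two Gram matrices into the products
    [B = V W V^H] and [A = V D W V^H], where the columns of [V] are the vectors
    [T(n, x_j)], [W] is the diagonal matrix of the weights and [D] the one of
    the values [mu (x_j)].  As [B] is invertible and [V] is square, [V] is
    invertible and so is [C = W V^H].  Hence [A B^-1 = V D C (V C)^-1 = V D V^-1]
    ([mulmx_quotient_intertwines]), and a matrix that is diagonalized by the
    columns of [V] has these columns as a complete system of eigenvectors
    ([eigensystem_of_eigenbasis]). *)

Lemma mulmx_col_of_diagonalizing (K : fieldType) (n : nat) (M : 'M[K]_n)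
    (lam : 'I_n -> K) (v : 'I_n -> 'cV[K]_n) :
  let V := \matrix_(i < n, j < n) v j i ord0 in
  M *m V = V *m diag_mx (\row_j lam j) ->
  forall j, M *m v j = lam j *: v j.
Proof.
move=> V MV j.
have colV : col j V = v j by apply/colP=> i; rewrite !mxE.
rewrite -colV colE mulmxA MV mul_mx_diag -!colE.
by apply/colP=> i; rewrite !mxE mulrC.
Qed.

(** Similar matrices have the same characteristic polynomial, because the
    intertwining relation lifts to the characteristic matrices and the nonzero
    determinant of [V] cancels. *)
Lemma char_poly_intertwined (K : fieldType) (n : nat) (M N V : 'M[K]_n) :
  V \in unitmx -> M *m V = V *m N -> char_poly M = char_poly N.
Proof.
move=> Vu MV; pose VX := map_mx (@polyC K) V.
have VX_neq0 : \det VX != 0.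
  by rewrite det_map_mx polyC_eq0 -unitfE -unitmxE.
apply: (mulIf VX_neq0).
rewrite /char_poly [RHS]mulrC -!det_mulmx /char_poly_mx.
by rewrite mulmxBl mulmxBr -!map_mxM MV scalar_mxC.
Qed.

Lemma eigensystem_of_eigenbasis (K : fieldType) (n : nat) (M : 'M[K]_n)
    (lam : 'I_n -> K) (v : 'I_n -> 'cV[K]_n) :
  let V := \matrix_(i < n, j < n) v j i ord0 in
  V \in unitmx -> M *m V = V *m diag_mx (\row_j lam j) ->
  eigensystem M lam v.
Proof.
move=> V Vu MV; split=> //.
- rewrite (char_poly_intertwined Vu MV) char_poly_trig ?diag_mx_is_trig //.
  by apply: eq_bigr => j _; rewrite !mxE eqxx.
- move=> j; split; last exact: mulmx_col_of_diagonalizing MV j.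
  (* A zero eigenvector would be a zero column of V, so that the j-th unit
     vector would lie in the kernel of V. *)
  apply/eqP=> vj0.
  have Ve0 : V *m delta_mx j ord0 = 0 :> 'cV_n.
    by rewrite -colE; apply/colP=> i; rewrite !mxE vj0 mxE.
  have /colP/(_ j) : delta_mx j ord0 = 0 :> 'cV[K]_n.
    by rewrite -[LHS](mulKmx Vu) Ve0 mulmx0.
  by rewrite !mxE !eqxx; apply/eqP/oner_neq0.
Qed.

(** The common right factor [C] cancels in the quotient of [V D C] by [V C]:
    [C (V C)^-1] is an inverse of [V]. *)
Lemma mulmx_quotient_intertwines (K : fieldType) (n : nat) (V D C : 'M[K]_n) :
  V *m C \in unitmx -> (V *m D *m C) *m invmx (V *m C) *m V = V *m D.
Proof.
move=> VCu.
have CV1 : C *m invmx (V *m C) *m V = 1%:M.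
  by apply: mulmx1C; rewrite mulmxA mulmxV.
by rewrite -!mulmxA [C *m _]mulmxA CV1 mulmx1.
Qed.

Theorem theorem2p3 (R : realType) (a b : R) (n : nat)
    (T : 'I_n -> R -> R[i]) (u : R -> R) (mu : R -> R[i])
    (A B : 'M[R[i]]_n)
    (hT : forall i, square_integrable a b (T i))
    (existsB : gram_exists a b (fun x => (u x)%:C) T)
    (existsA : gram_exists a b (fun x => (u x)%:C * mu x) T)
    (defB : B = gram_mx a b (fun x => (u x)%:C) T)
    (defA : A = gram_mx a b (fun x => (u x)%:C * mu x) T)
    (B_inv : B \in unitmx)
    (x : 'I_n -> R) (w : 'I_n -> R[i])
    (quad : is_quadrature a b x w)
    (quadB : integratesB T x w B)
    (quadA : integratesA mu T x w A) :
  eigensystem (A *m invmx B) (fun j => mu (x j)) (fun j => Tvec T (x j)).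
Proof.
pose V := \matrix_(i < n, j < n) Tvec T (x j) i ord0.
pose D := diag_mx (\row_j mu (x j)).
(* C is the product of the diagonal matrix of the weights and V^H. *)
pose C := \matrix_(j < n, k < n) (w j * (T k (x j))^*).
have B_VC : B = V *m C.
  apply/matrixP=> i k; rewrite quadB mxE; apply: eq_bigr => j _.
  by rewrite !mxE mulrCA mulrA.
have A_VDC : A = V *m D *m C.
  apply/matrixP=> i k; rewrite quadA mul_mx_diag mxE; apply: eq_bigr => j _.
  rewrite !mxE [RHS]mulrA; congr (_ * _).
  by rewrite [RHS]mulrC -mulrA [mu _ * _]mulrC.
have VCu : V *m C \in unitmx by rewrite -B_VC.
apply: eigensystem_of_eigenbasis.
  by move: VCu; rewrite unitmx_mul => /andP[].
by rewrite A_VDC B_VC; exact: mulmx_quotient_intertwines.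
Qed.
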